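(* Consider the setting and algorithm described in the context. Let $\gamma>0$ and $K_0\ge0$ be such that for all $k\ge K_0$: $\gamma_k=\gamma$, $\delta_k=\delta:=2\nu+L_{\nabla h}+\frac{2\|A\|^2}{\gamma}$ and $\|z^{k+1}\|\le\min\left(\frac{\varepsilon}{\gamma},\sqrt{\frac{2\varepsilon}{\gamma}}\right)$. Let $0<m\le M$ be constants with $m<f(Kx^k)\le M$ for all $k\ge1$, and let $K_1\ge K_0+1$ be such that $m\le\langle Kx^k,y^k\rangle-f^*(y^k)\le f(Kx^k)\le M$ for all $k\ge K_1$. Define $\Gamma(x,y,z,u):=\frac{\Psi(x,z,u,\delta,\gamma)}{\langle Kx,y\rangle-f^*(y)}$ on $\{(x,y)\in\mathbb{R}^n\times\operatorname{dom}f^*:\langle Kx,y\rangle-f^*(y)>m/2\}\times\operatorname{dom}g^*\times\mathbb{R}^n$. Let $\theta_k$ be the scalars produced by the algorithm, $\bar\theta:=\lim_{k\to\infty}\theta_k$ (which exists), and $\Omega$ the set of accumulation points of $\{(x^k,y^k,z^k,u^k)\}$. Then: (i) there exists $c>0$ such that for all $k\ge K_1$, $\Gamma(x^{k+1},y^{k+1},z^{k+1},u^{k+1})\le\Gamma(x^k,y^k,z^k,u^k)-c\|x^k-x^{k+1}\|^2-c\|u^k-u^{k+1}\|^2-c\|z^k-z^{k+1}\|^2$; (ii) $\lim_{k\to\infty}\Gamma(x^k,y^k,z^k,u^k)$ exists and equals $\bar\theta$; (iii) $\Gamma(\bar x,\bar y,\bar z,\bar u)=\bar\theta$ for every $(\bar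 x,\bar y,\bar z,\bar u)\in\Omega$.
   Context: Setting: $\mathcal{S}\subseteq\mathbb{R}^n$ nonempty, convex, compact; $A:\mathbb{R}^n\to\mathbb{R}^s$, $K:\mathbb{R}^n\to\mathbb{R}^p$ linear with adjoints $A^*,K^*$ and operator norm $\|A\|$; $g:\mathbb{R}^s\to\mathbb{R}\cup\{+\infty\}$ proper, convex, lsc; $h:\mathbb{R}^n\to\mathbb{R}$ differentiable on an open set containing $\mathcal{S}$ with $L_{\nabla h}$-Lipschitz gradient there; $f:\mathbb{R}^p\to\mathbb{R}\cup\{+\infty\}$ proper, convex, lsc with $K(\mathcal{S})\subseteq\operatorname{int}(\operatorname{dom}f)$ and $f(Kx)>0$ on $\mathcal{S}$; $\mathcal{S}\cap A^{-1}(\operatorname{dom}g)\ne\emptyset$, $\inf_{x\in\mathcal{S}}\{g(Ax)+h(x)\}>0$; $A(\mathcal{S})\subseteq\operatorname{dom}(\partial g)$ and there is $\ell>0$ with $\operatorname{dist}(0,\partial g(Ax))\le\ell$ for all $x\in\mathcal{S}$. Notation: $f^*,g^*$ Fenchel conjugates; $\iota_{\mathcal{S}}$ indicator; $\operatorname{Proj}_{\mathcal{S}}$ projection; $\operatorname{prox}_{\varphi,\kappa}(x)=\arg\min_y\{\varphi(y)+\frac1{2\kappa}\|y-x\|^2\}$; $\Psi(x,z,u,\delta,\gamma):=\langle z,Ax\rangle-g^*(z)+h(x)+\iota_{\mathcal{S}}(x)+\frac{\delta}{2}\|x-u\|^2-\frac{\gamma}{2}\|z\|^2$. Algorithm: given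 $0<\beta<2$, $\nu>0$, $0<q<1$, $\delta_0,\theta_0>0$, $\gamma_0=1$, $\varepsilon>0$ and $(x^0,z^0,u^0)$, for $k\ge0$: choose $y^{k+1}\in\partial f(Kx^k)$; $x^{k+1}:=\operatorname{Proj}_{\mathcal{S}}(u^k+\frac{\theta_k}{\delta_k}K^*y^{k+1}-\frac1{\delta_k}\nabla h(x^k)-\frac1{\delta_k}A^*z^k)$; $u^{k+1}:=(1-\beta)u^k+\beta x^{k+1}$; take the smallest $j_k\ge0$ such that with $\gamma_{k,j_k}:=\gamma_kq^{j_k}$, $z^{k+1,j_k}:=\operatorname{prox}_{g^*,1/\gamma_{k,j_k}}(Ax^{k+1}/\gamma_{k,j_k})$ one has $\theta_{k+1}:=\Psi(x^{k+1},z^{k+1,j_k},u^{k+1},\delta_k,\gamma_{k,j_k})/f(Kx^{k+1})>0$; set $\gamma_{k+1}:=\gamma_{k,j_k}$, $\delta_{k+1}:=2\nu+L_{\nabla h}+2\|A\|^2/\gamma_{k+1}$, $z^{k+1}:=z^{k+1,j_k}$; if $\|z^{k+1}\|>\min(\varepsilon/\gamma_{k+1},\sqrt{2\varepsilon/\gamma_{k+1}})$, replace $\gamma_{k+1}$ by $\gamma_{k+1}q$ and recompute $\delta_{k+1}$ by the same formula. *)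

(* Defs.v *)
From HB Require Import structures.
From mathcomp Require Import all_boot all_order all_algebra.
From mathcomp Require Import all_classical all_reals all_analysis.
Set Implicit Arguments. Unset Strict Implicit. Unset Printing Implicit Defensive.
Import Order.TTheory GRing.Theory Num.Theory.
Import numFieldNormedType.Exports.
Local Open Scope classical_set_scope.
Local Open Scope ring_scope.

Section Defs.
Variable R : realType.

Definition dotp {n : nat} (u v : 'cV[R]_n) : R := \sum_(i < n) u i 0 * v i 0.
Definition nrm {n : nat} (u : 'cV[R]_n) : R := Num.sqrt (dotp u u).

Definition opnorm {s n : nat} (A : 'M[R]_(s, n)) : R :=
  sup [set nrm (A *m x) | x in [set x : 'cV[R]_n | nrm x <= 1]].

Definition convex_set {n : nat} (S : set 'cV[R]_n) : Prop :=
  forall (x y : 'cV[R]_n) (t : R), S x -> S y -> 0 <= t <= 1 -> S (t *: x + (1 - t) *: y).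

Definition no_minfty {n : nat} (g : 'cV[R]_n -> \bar R) : Prop :=
  forall x, g x != -oo%E.
Definition edom {n : nat} (g : 'cV[R]_n -> \bar R) : set 'cV[R]_n :=
  [set x | (g x < +oo)%E].
Definition proper_fun {n : nat} (g : 'cV[R]_n -> \bar R) : Prop :=
  no_minfty g /\ edom g !=set0.
Definition convex_fun {n : nat} (g : 'cV[R]_n -> \bar R) : Prop :=
  forall (x y : 'cV[R]_n) (t : R), 0 < t < 1 ->
    (g ((t *: x + (1 - t) *: y)%R) <= t%:E * g x + (1 - t)%R%:E * g y)%E.
Definition lsc_fun {n : nat} (g : 'cV[R]_n -> \bar R) : Prop :=
  forall a : R, closed [set x | (g x <= a%:E)%E].

Definition fconj {n : nat} (g : 'cV[R]_n -> \bar R) (z : 'cV[R]_n) : \bar R :=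
  ereal_sup [set ((dotp z x)%:E - g x)%E | x in [set: 'cV[R]_n]].

Definition subdiff {n : nat} (g : 'cV[R]_n -> \bar R) (x : 'cV[R]_n) : set 'cV[R]_n :=
  [set v | g x \is a fin_num /\ forall y, (g x + (dotp v (y - x))%:E <= g y)%E].

Definition dist0 {n : nat} (C : set 'cV[R]_n) : R := inf [set nrm v | v in C].

Definition indic {n : nat} (S : set 'cV[R]_n) (x : 'cV[R]_n) : \bar R :=
  if `[< S x >] then 0%E else +oo%E.

Definition Proj {n : nat} (S : set 'cV[R]_n) (x : 'cV[R]_n) : 'cV[R]_n :=
  xget 0 [set p | S p /\ forall y, S y -> nrm (p - x) <= nrm (y - x)].
Definition prox {n : nat} (phi : 'cV[R]_n -> \bar R) (kappa : R) (x : 'cV[R]_n)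
  : 'cV[R]_n :=
  xget 0 [set p | phi p \is a fin_num /\ forall y,
     (phi p + ((2 * kappa)^-1 * nrm (p - x) ^+ 2)%:E
       <= phi y + ((2 * kappa)^-1 * nrm (y - x) ^+ 2)%:E)%E].

Definition has_gradient_on {n : nat} (h : 'cV[R]_n -> R) (gh : 'cV[R]_n -> 'cV[R]_n)
  (U : set 'cV[R]_n) : Prop :=
  forall x, U x -> forall e : R, 0 < e -> exists2 d : R, 0 < d &
    forall v, nrm v < d -> `| h (x + v) - h x - dotp (gh x) v | <= e * nrm v.

Definition accum_pt {n p s : nat} (x : nat -> 'cV[R]_n) (y : nat -> 'cV[R]_p)
  (z : nat -> 'cV[R]_s) (u : nat -> 'cV[R]_n)
  (xb : 'cV[R]_n) (yb : 'cV[R]_p) (zb : 'cV[R]_s) (ub : 'cV[R]_n) : Prop :=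
  exists phi : nat -> nat, (forall k, (phi k < phi k.+1)%N) /\
    (x \o phi) @ \oo --> xb /\ (y \o phi) @ \oo --> yb /\
    (z \o phi) @ \oo --> zb /\ (u \o phi) @ \oo --> ub.

Definition Psi {n s : nat} (A : 'M[R]_(s, n)) (g : 'cV[R]_s -> \bar R)
  (h : 'cV[R]_n -> R) (S : set 'cV[R]_n)
  (x : 'cV[R]_n) (z : 'cV[R]_s) (u : 'cV[R]_n) (delta gamma : R) : \bar R :=
  ((dotp z (A *m x))%:E - fconj g z + (h x)%:E + indic S x
   + (delta / 2 * nrm (x - u) ^+ 2)%:E - (gamma / 2 * nrm z ^+ 2)%:E)%E.

Definition Gam {n s p : nat} (A : 'M[R]_(s, n)) (K : 'M[R]_(p, n))
  (g : 'cV[R]_s -> \bar R) (h : 'cV[R]_n -> R) (f : 'cV[R]_p -> \bar R)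
  (S : set 'cV[R]_n) (delta gamma : R)
  (x : 'cV[R]_n) (y : 'cV[R]_p) (z : 'cV[R]_s) (u : 'cV[R]_n) : \bar R :=
  (Psi A g h S x z u delta gamma
   * ((dotp (K *m x) y - fine (fconj f y))^-1)%:E)%E.

(* algorithm, step for z: candidate z^{k+1,i} for gamma_k = G *)
Definition cand_z {n s : nat} (A : 'M[R]_(s, n)) (g : 'cV[R]_s -> \bar R)
  (q G : R) (xk1 : 'cV[R]_n) (i : nat) : 'cV[R]_s :=
  prox (fconj g) (G * q ^+ i)^-1 ((G * q ^+ i)^-1 *: (A *m xk1)).

(* the quotient Psi(x^{k+1}, z^{k+1,i}, u^{k+1}, delta_k, gamma_{k,i}) / f(K x^{k+1})
   (both quantities are finite at the points where it is used) *)
Definition cand_ratio {n s p : nat} (A : 'M[R]_(s, n)) (K : 'M[R]_(p, n))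
  (g : 'cV[R]_s -> \bar R) (h : 'cV[R]_n -> R) (f : 'cV[R]_p -> \bar R)
  (S : set 'cV[R]_n) (q G D : R) (xk1 uk1 : 'cV[R]_n) (i : nat) : R :=
  fine (Psi A g h S xk1 (cand_z A g q G xk1 i) uk1 D (G * q ^+ i))
  / fine (f (K *m xk1)).

End Defs.

(* Main.v *)
(* Write Psi_k for Psi at the k-th iterate, d_k = <K x^k, y^k> - f^*(y^k), and let k >= K1.
   Strong convexity of the projection step, the descent lemma for h, the relaxation of u and the
   optimality of the proximal step for z (with AM-GM on <z^{k+1} - z^k, A(x^{k+1} - x^k)>) give
     Psi_{k+1} <= theta_k d_{k+1} - c0 (|dx|^2 + |du|^2 + |dz|^2),
   because the linearization y^{k+1} in df(K x^k) turns Psi_k = theta_k f(K x^k) into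
   theta_k d_{k+1}. Since d_k <= f(K x^k), also theta_k <= Psi_k / d_k = Gamma_k. Hence
   Gamma_{k+1} <= theta_k - c (...) <= Gamma_k - c (...), which yields (i), and (ii) by
   monotonicity. For (iii), g^* converges along z^k by proximal optimality and lower
   semicontinuity; as x^k - x^{k+1} -> 0, the subgradients y^{k+1} of f at K x^k converge to a
   subgradient at K xbar, so d_k tends to the denominator at the accumulation point. *)
Require Import Defs.
From HB Require Import structures.
From mathcomp Require Import all_boot all_order all_algebra.
From mathcomp Require Import all_classical all_reals all_analysis.
From mathcomp Require Import ring lra.
Import Order.TTheory GRing.Theory Num.Theory.
Import numFieldNormedType.Exports.
Local Open Scope classical_set_scope.
Local Open Scope ring_scope.

(** * Euclidean inner product, norm and operator norm *)

Section Euclidean.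
Context {R : realType}.

Lemma dotpC {n} (u v : 'cV[R]_n) : dotp u v = dotp v u.
Proof. by apply: eq_bigr => i _; rewrite mulrC. Qed.

Lemma dotpDl {n} (u v w : 'cV[R]_n) : dotp (u + v) w = dotp u w + dotp v w.
Proof. by rewrite -big_split; apply: eq_bigr => i _; rewrite mxE mulrDl. Qed.

Lemma dotpZl {n} (a : R) (u v : 'cV[R]_n) : dotp (a *: u) v = a * dotp u v.
Proof. by rewrite /dotp mulr_sumr; apply: eq_bigr => i _; rewrite mxE mulrA. Qed.

Lemma dotpNl {n} (u v : 'cV[R]_n) : dotp (- u) v = - dotp u v.
Proof. by rewrite -scaleN1r dotpZl mulN1r. Qed.

Lemma dotpDr {n} (u v w : 'cV[R]_n) : dotp w (u + v) = dotp w u + dotp w v.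
Proof. by rewrite dotpC dotpDl !(dotpC w). Qed.

Lemma dotpZr {n} (a : R) (u v : 'cV[R]_n) : dotp u (a *: v) = a * dotp u v.
Proof. by rewrite dotpC dotpZl dotpC. Qed.

Lemma dotpNr {n} (u v : 'cV[R]_n) : dotp u (- v) = - dotp u v.
Proof. by rewrite dotpC dotpNl dotpC. Qed.

Definition dotpE := (@dotpDl, @dotpDr, @dotpNl, @dotpNr, @dotpZl, @dotpZr).

Lemma dotp_trmx {n p} (B : 'M[R]_(p, n)) (v : 'cV[R]_p) (w : 'cV[R]_n) :
  dotp (B^T *m v) w = dotp (B *m w) v.
Proof.
have dE k (a b : 'cV[R]_k) : dotp a b = (a^T *m b) 0 0.
  by rewrite mxE; apply: eq_bigr => i _; rewrite mxE.
by rewrite [RHS]dotpC !dE trmx_mul trmxK mulmxA.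
Qed.

Lemma dotp_ge0 {n} (u : 'cV[R]_n) : 0 <= dotp u u.
Proof. by apply: sumr_ge0 => i _; rewrite -expr2 sqr_ge0. Qed.

Lemma nrm_ge0 {n} (u : 'cV[R]_n) : 0 <= nrm u.
Proof. exact: sqrtr_ge0. Qed.

Lemma nrm_sqr {n} (u : 'cV[R]_n) : nrm u ^+ 2 = dotp u u.
Proof. by rewrite sqr_sqrtr// dotp_ge0. Qed.

Lemma nrmZ {n} (a : R) (u : 'cV[R]_n) : nrm (a *: u) = `|a| * nrm u.
Proof.
by rewrite /nrm !dotpE mulrA -expr2 sqrtrM ?sqr_ge0// sqrtr_sqr.
Qed.

Lemma nrmN {n} (u : 'cV[R]_n) : nrm (- u) = nrm u.
Proof. by rewrite /nrm !dotpE opprK. Qed.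

Lemma dotp_eq0 {n} (u : 'cV[R]_n) : dotp u u = 0 -> u = 0.
Proof.
move=> /eqP; rewrite psumr_eq0; last by move=> i _; rewrite -expr2 sqr_ge0.
move=> /allP u0; apply/colP => i; rewrite mxE; apply/eqP.
by rewrite -sqrf_eq0 expr2; apply: (implyP (u0 i _)); rewrite ?mem_index_enum.
Qed.

(** The squared length of [dotp v v *: u - dotp u v *: v] is [dotp v v] times a Gram determinant;
    the case [dotp v v = 0] is split off. *)
Lemma dotp_le_nrm {n} (u v : 'cV[R]_n) : dotp u v <= nrm u * nrm v.
Proof.
have [/dotp_eq0 ->|v0] := eqVneq (dotp v v) 0.
  by rewrite -(scale0r (0 : 'cV[R]_n)) !dotpE mul0r mulr_ge0 ?nrm_ge0.
have v_gt0 : 0 < dotp v v by rewrite lt_def v0 dotp_ge0.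
apply: le_trans (ler_norm _) _.
rewrite -(@ler_pXn2r _ 2)// ?nnegrE ?mulr_ge0 ?nrm_ge0// exprMn !nrm_sqr real_normK ?num_real//.
have := dotp_ge0 (dotp v v *: u - dotp u v *: v).
rewrite !dotpE (dotpC v u).
rewrite [X in 0 <= X](_ : _ = dotp v v * (dotp u u * dotp v v - dotp u v ^+ 2)).
  by rewrite pmulr_rge0// subr_ge0.
ring.
Qed.

Lemma coord_le_nrm {n} (u : 'cV[R]_n) i : `|u i 0| <= nrm u.
Proof.
rewrite -(@ler_pXn2r _ 2)// ?nnegrE ?nrm_ge0// nrm_sqr real_normK ?num_real// expr2.
by rewrite /dotp (bigD1 i)//= lerDl sumr_ge0// => k _; rewrite -expr2 sqr_ge0.
Qed.

(** The topology on column vectors comes from the maximum norm, so this comparison turns Euclidean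
    estimates into limits. *)
Lemma mx_norm_le_nrm {n} (u : 'cV[R]_n) : `|u| <= nrm u.
Proof.
rewrite [`|u|]/Num.norm/= mx_normrE; apply/bigmax_leP; split => [|[i k] _].
  exact: nrm_ge0.
by rewrite /= ord1 coord_le_nrm.
Qed.

(** Cauchy-Schwarz on each row gives the Frobenius norm as a bound. Boundedness is what makes the
    [sup] in [opnorm] an upper bound. *)
Lemma mulmx_nrm_bounded {n s} (B : 'M[R]_(s, n)) :
  exists C, forall v, nrm v <= 1 -> nrm (B *m v) <= C.
Proof.
exists (Num.sqrt (\sum_i dotp (row i B)^T (row i B)^T)) => v v1.
rewrite ler_sqrt; last by apply: sumr_ge0 => i _; exact: dotp_ge0.
apply: ler_sum => i _.
have -> : (B *m v) i 0 = dotp (row i B)^T v.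
  by rewrite mxE; apply: eq_bigr => k _; rewrite !mxE.
rewrite -expr2 -real_normK ?num_real// -nrm_sqr ler_pXn2r ?nnegrE ?nrm_ge0// ler_norml.
have le1 w : dotp (row i B)^T w <= nrm (row i B)^T * nrm w := dotp_le_nrm _ _.
have := le1 v; have := le1 (- v); rewrite nrmN dotpNr.
have := nrm_ge0 (row i B)^T; move: (nrm _) (dotp _ _) => a b a0.
by move=> h1 h2; apply/andP; split; nra.
Qed.

Lemma nrm_mulmx {n s} (B : 'M[R]_(s, n)) v : nrm (B *m v) <= opnorm B * nrm v.
Proof.
have [v0|v0] := eqVneq (nrm v) 0.
  have -> : v = 0 by apply: dotp_eq0; rewrite -nrm_sqr v0 expr0n.
  by rewrite mulmx0 -(scale0r (0 : 'cV[R]_n)) -(scale0r (0 : 'cV[R]_s)) !nrmZ normr0 !mul0r mulr0.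
have v_gt0 : 0 < nrm v by rewrite lt_def v0 nrm_ge0.
have : nrm (B *m ((nrm v)^-1 *: v)) <= opnorm B.
  have [C hC] := mulmx_nrm_bounded B.
  apply: sup_upper_bound.
    by split; [exists (nrm (B *m 0)), 0 => //=; rewrite -(scale0r 0) nrmZ normr0 mul0r
              |exists C => _ [w /= w1 <-]; exact: hC].
  by exists ((nrm v)^-1 *: v) => //=; rewrite nrmZ gtr0_norm ?invr_gt0// mulVf.
rewrite -scalemxAr nrmZ gtr0_norm ?invr_gt0//.
by rewrite mulrC ler_pdivrMr.
Qed.

End Euclidean.

(** * Limits of inner products, norms and matrix images *)

Section Convergence.
Context {R : realType}.

Lemma cvg_dotp {T} {F : set_system T} {FF : Filter F} {n}
    (u v : T -> 'cV[R]_n) (a b : 'cV[R]_n) :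
  u @ F --> a -> v @ F --> b -> dotp (u t) (v t) @[t --> F] --> dotp a b.
Proof.
move=> ua vb; rewrite /dotp.
apply: cvg_big => [|i _]; first exact: add_continuous.
have coord (w : T -> 'cV[R]_n) (l : 'cV[R]_n) : w @ F --> l -> w t i 0 @[t --> F] --> l i 0.
  by move=> ?; apply: (@continuous_cvg _ _ _ F _ w (fun M : 'cV[R]_n => M i 0)) => //;
  exact: coord_continuous.
by apply: cvgM; exact: coord.
Qed.

Lemma cvg_nrm {T} {F : set_system T} {FF : Filter F} {n}
    (u : T -> 'cV[R]_n) (a : 'cV[R]_n) : u @ F --> a -> nrm (u t) @[t --> F] --> nrm a.
Proof.
move=> ua; apply: (@continuous_cvg _ _ _ F _ (fun t => dotp (u t) (u t)) Num.sqrt).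
  exact: sqrt_continuous.
exact: cvg_dotp.
Qed.

Lemma cvg_nrmP {T} {F : set_system T} {FF : Filter F} {n}
    (u : T -> 'cV[R]_n) (a : 'cV[R]_n) :
  u @ F --> a <-> nrm (u t - a) @[t --> F] --> 0.
Proof.
split=> [ua|ua].
  have nrm0 : nrm (0 : 'cV[R]_n) = 0 by rewrite -(scale0r 0) nrmZ normr0 mul0r.
  by rewrite -nrm0 -(subrr a); apply: cvg_nrm; apply: cvgB => //; exact: cvg_cst.
apply/cvgrPdist_le => e e0; move/cvgrPdist_le : ua => /(_ _ e0).
apply: filterS => t; rewrite sub0r normrN ger0_norm ?nrm_ge0//.
by move=> h; rewrite distrC (le_trans (mx_norm_le_nrm _)).
Qed.

Lemma cvg_mulmxl {T} {F : set_system T} {FF : Filter F} {n s}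
    (B : 'M[R]_(s, n)) (u : T -> 'cV[R]_n) (a : 'cV[R]_n) :
  u @ F --> a -> B *m u t @[t --> F] --> B *m a.
Proof.
move/cvg_nrmP => ua; apply/cvg_nrmP.
apply: (@squeeze_cvgr _ _ _ _ (fun=> 0) (fun t => opnorm B * nrm (u t - a))).
- by apply: nearW => t; rewrite nrm_ge0 -mulmxBr nrm_mulmx.
- exact: cvg_cst.
- by rewrite -(mulr0 (opnorm B)); apply: cvgMr.
Qed.

End Convergence.

(** * Minimization of a convex function plus a quadratic *)

Section StronglyConvexMinimization.
Local Set Implicit Arguments.
Local Unset Strict Implicit.
Context {R : realType} {n : nat}.
Implicit Types (D : set 'cV[R]_n) (phi : 'cV[R]_n -> R) (c lb t : R) (a p x y : 'cV[R]_n).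

Definition convex_on D phi := forall x y t, D x -> D y -> 0 < t < 1 ->
  D (t *: x + (1 - t) *: y) /\ phi (t *: x + (1 - t) *: y) <= t * phi x + (1 - t) * phi y.

Lemma convex_on_quadratic D phi c a x y t : convex_on D phi -> D x -> D y -> 0 < t < 1 ->
  phi (t *: x + (1 - t) *: y) + c * nrm (t *: x + (1 - t) *: y - a) ^+ 2
    + c * (t * (1 - t)) * nrm (x - y) ^+ 2
  <= t * (phi x + c * nrm (x - a) ^+ 2) + (1 - t) * (phi y + c * nrm (y - a) ^+ 2).
Proof.
move=> cvx Dx Dy t01; have [_] := cvx _ _ _ Dx Dy t01.
rewrite !nrm_sqr !dotpE !(dotpC _ x) !(dotpC _ a) => ?; nra.
Qed.

(** Compare [p] with [t *: x + (1 - t) *: p]: minimality and the quadratic gap give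
    [(1 - t) * B <= d - e] after division by [t], and small [t] suffices. *)
Lemma strongly_convex_growth D phi c a p x : convex_on D phi ->
  (forall w, D w -> phi p + c * nrm (p - a) ^+ 2 <= phi w + c * nrm (w - a) ^+ 2) ->
  D p -> D x ->
  phi p + c * nrm (p - a) ^+ 2 + c * nrm (x - p) ^+ 2 <= phi x + c * nrm (x - a) ^+ 2.
Proof.
move=> cvx pmin Dp Dx.
set d := phi x + _; set e := phi p + _; set B := c * nrm (x - p) ^+ 2.
have step t : 0 < t < 1 -> (1 - t) * B <= d - e.
  move=> /[dup] t01 /andP[t0 t1].
  have := convex_on_quadratic c a cvx Dx Dp t01.
  have [Dw _] := cvx _ _ _ Dx Dp t01; have := pmin _ Dw; rewrite -/d -/e.
  move: (phi _ + _) => W eW; rewrite (_ : c * _ * _ = t * ((1 - t) * B)); last by rewrite /B; ring.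
  by move=> h; rewrite -(ler_pM2l t0); lra.
have de : 0 <= d - e by rewrite subr_ge0; exact: pmin.
rewrite -lerBrDl leNgt; apply/negP => dB.
have B0 : 0 < B by lra.
(* If [d - e < B], this [t] makes the left side the midpoint of [B] and [d - e], which exceeds
   [d - e]; no limit in [t] is taken. *)
suff : (1 - (B - (d - e)) / (2 * B)) * B <= d - e.
  rewrite [X in X <= _](_ : _ = (B + (d - e)) / 2); last by field; rewrite gt_eqF.
  by move=> ?; lra.
apply: step; rewrite divr_gt0 ?ltr_pdivrMr; lra.
Qed.

(* A minimizing sequence is Cauchy: the midpoint inequality bounds the squared
   distance of two points by how far their values are from the infimum. *)
Lemma strongly_convex_argmin D phi c a lb : 0 < c -> D !=set0 -> convex_on D phi ->
  (forall r, closed [set x | D x /\ phi x <= r]) ->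
  (forall x, D x -> lb <= phi x + c * nrm (x - a) ^+ 2) ->
  exists p, D p /\
    forall x, D x -> phi p + c * nrm (p - a) ^+ 2 <= phi x + c * nrm (x - a) ^+ 2.
Proof.
move=> c0 [x0 Dx0] cvx clo lbP.
pose Q x := phi x + c * nrm (x - a) ^+ 2.
pose E := [set Q x | x in D]; pose l := inf E.
have Einf : has_inf E.
  by split; [exists (Q x0), x0|exists lb => _ [x Dx <-]; exact: lbP].
have lQ x : D x -> l <= Q x by move=> Dx; apply: ge_inf; [case: Einf|exists x].
have /choice[w wP] : forall i : nat, exists x, D x /\ Q x < l + i.+1%:R^-1.
  move=> i; have /(inf_adherent)/(_ Einf)[_ [x Dx <-] Qx] : 0 < i.+1%:R^-1 :> R.
    by rewrite invr_gt0.
  by exists x.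
have wD i : D (w i) by have [] := wP i.
have dist i k : c * nrm (w i - w k) ^+ 2 <= 2 * (i.+1%:R^-1 + k.+1%:R^-1).
  have half : 0 < (2^-1 : R) < 1 by apply/andP; split; lra.
  have := convex_on_quadratic c a cvx (wD i) (wD k) half.
  have [Dm _] := cvx _ _ _ (wD i) (wD k) half.
  have := lQ _ Dm; have [_] := wP i; have [_] := wP k; rewrite /Q.
  move: (nrm (w i - w k) ^+ 2) (phi (_ + _) + _) (phi (w i) + _) (phi (w k) + _).
  rewrite (_ : c * _ = c / 4); last by field.
  move: (i.+1%:R^-1) (k.+1%:R^-1) => I J b W U V; rewrite mulrAC.
  by move: (c * b) => B; lra.
have inv0 : (i.+1%:R^-1 : R) @[i --> \oo] --> 0 by exact: cvg_harmonic.
have /cauchy_cvg/cvg_ex[p wp] : cauchy (w @ \oo).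
  apply/cauchy_ballP => e e0.
  have ce : 0 < c * e ^+ 2 / 4 by rewrite divr_gt0// mulr_gt0// exprn_gt0.
  have small : \forall i \near \oo, i.+1%:R^-1 < c * e ^+ 2 / 4 by apply: (cvgr_lt _ inv0).
  near_simpl; near=> i k.
  rewrite -ball_normE /=. apply: (le_lt_trans (mx_norm_le_nrm (w i - w k))).
  rewrite -(@ltr_pXn2r _ 2)// ?nnegrE ?nrm_ge0 ?(ltW e0)//.
  rewrite -(ltr_pM2l c0); apply: le_lt_trans (dist i k) _.
  have i_small : i.+1%:R^-1 < c * e ^+ 2 / 4 by near: i; exact: small.
  have k_small : k.+1%:R^-1 < c * e ^+ 2 / 4 by near: k; exact: small.
  move: i_small k_small; move: (i.+1%:R^-1) (k.+1%:R^-1) => I J; lra.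
(* Closed sublevel sets act as lower semicontinuity: [phi (w i)] is eventually below a fixed level,
   and the limit [p] inherits that level. *)
have pe e : 0 < e -> D p /\ phi p <= l - c * nrm (p - a) ^+ 2 + e.
  move=> e0; apply: (closed_cvg _ (clo _) _ _ wp).
  have hc : i.+1%:R^-1 - c * nrm (w i - a) ^+ 2 @[i --> \oo] --> 0 - c * nrm (p - a) ^+ 2.
    apply: cvgB => //; apply: cvgMr; rewrite !expr2.
    by apply: cvgM; apply: cvg_nrm; apply: cvgB => //; exact: cvg_cst.
  have : \forall i \near \oo, i.+1%:R^-1 - c * nrm (w i - a) ^+ 2 <= e - c * nrm (p - a) ^+ 2.
    by apply: (cvgr_le _ hc); lra.
  apply: filterS => i h; split; first exact: wD.
  have [_] := wP i; move: h; rewrite /Q; move: (i.+1%:R^-1) => I; lra.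
exists p; split; first by have [] := pe 1 ltr01.
move=> x Dx; apply: le_trans (lQ _ Dx); apply/ler_addgt0Pr => e e0.
have [_] := pe e e0; lra.
Unshelve. all: by end_near. Qed.

End StronglyConvexMinimization.

(** * Derivatives along lines and the descent lemma *)

Section Smoothness.
Context {R : realType}.
Local Set Implicit Arguments.
Local Unset Strict Implicit.

Lemma is_derive_of_eps (F : R -> R) t l :
  (forall e, 0 < e -> exists2 d, 0 < d &
     forall s, `|s| < d -> `|F (t + s) - F t - l * s| <= e * `|s|) ->
  is_derive t 1 F l.
Proof.
move=> hF.
have hcvg : s^-1 *: ((F \o shift t) (s *: 1) - F t) @[s --> 0^'] --> l.
  apply/cvgrPdist_le => e e0; have [d d0 hd] := hF _ e0.
  near=> s.
  have s0 : s != 0 by near: s; exact: nbhs_dnbhs_neq.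
  have sd : `|s| < d by near: s; exact: dnbhs0_lt.
  have := hd _ sd; rewrite -ler_pdivrMr ?normr_gt0// -normfV -normrM => h.
  apply: le_trans h; rewrite -normrN /= [s *: 1]mulr1 (addrC s) le_eqVlt; apply/orP; left.
  by apply/eqP; congr (`| _ |); rewrite /GRing.scale/=; field.
by split; [apply/cvg_ex; exists l|exact: cvg_lim].
Unshelve. all: by end_near. Qed.

Variables (n : nat) (U : set 'cV[R]_n) (h : 'cV[R]_n -> R) (gh : 'cV[R]_n -> 'cV[R]_n).
Hypothesis hgrad : has_gradient_on h gh U.

Lemma is_derive_along_line (x v : 'cV[R]_n) (t : R) : U (x + t *: v) ->
  is_derive t 1 (fun s : R => h (x + s *: v)) (dotp (gh (x + t *: v)) v).
Proof.
move=> Ux; apply: is_derive_of_eps => e e0.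
(* Dividing by [nrm v + 1] instead of [nrm v] covers [v = 0]. *)
have v1 : 0 < nrm v + 1 by have := nrm_ge0 v; lra.
have [d d0 hd] := hgrad Ux (divr_gt0 e0 v1).
exists (d / (nrm v + 1)); first exact: divr_gt0.
move=> s; rewrite ltr_pdivlMr// => sd.
have sv : `|s| * nrm v <= `|s| * (nrm v + 1) by rewrite ler_wpM2l// lerDl.
have := hd (s *: v); rewrite nrmZ => /(_ (le_lt_trans sv sd)).
rewrite scalerDl addrA dotpZr [s * _]mulrC => /le_trans; apply.
rewrite [leRHS](_ : _ = e / (nrm v + 1) * (`|s| * (nrm v + 1))).
  by rewrite ler_wpM2l// ltW// divr_gt0.
by field; rewrite gt_eqF.
Qed.

(** With tolerance 1 in the definition of the gradient, [h (w t)] is squeezed between the affine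
    model minus and plus [nrm (w t - x)]. *)
Lemma cvg_of_gradient T (F : set_system T) (FF : Filter F) (w : T -> 'cV[R]_n) x :
  U x -> w @ F --> x -> h (w t) @[t --> F] --> h x.
Proof.
move=> Ux wx; have [d d0 hd] := hgrad Ux ltr01.
have near_d := cvgr_lt _ ((cvg_nrmP w x).1 wx) _ d0.
have lin : dotp (gh x) (w t - x) @[t --> F] --> 0.
  have -> : 0 = dotp (gh x) (x - x) by rewrite subrr -(scale0r (0 : 'cV[R]_n)) dotpZr mul0r.
  by apply: cvg_dotp; [exact: cvg_cst|apply: cvgB => //; exact: cvg_cst].
apply: (@squeeze_cvgr _ _ _ _ (fun t => h x + dotp (gh x) (w t - x) - nrm (w t - x))
   (fun t => h x + dotp (gh x) (w t - x) + nrm (w t - x))).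
- near=> t; have /hd : nrm (w t - x) < d by near: t; exact: near_d.
  rewrite mul1r (addrC x) subrK ler_norml.
  by move=> /andP[? ?]; apply/andP; split; lra.
- rewrite -[X in _ --> X]subr0 -[X in _ --> X - _]addr0.
  by apply: cvgB; [apply: cvgD => //; exact: cvg_cst|exact/cvg_nrmP].
- rewrite -[X in _ --> X]addr0 -[X in _ --> X + _]addr0.
  by apply: cvgD; [apply: cvgD => //; exact: cvg_cst|exact/cvg_nrmP].
Unshelve. all: by end_near. Qed.

Lemma is_derive_quadratic (a b t : R) :
  is_derive t 1 (fun s : R => s * a + s ^+ 2 * b) (a + 2 * t * b).
Proof.
apply: is_derive_of_eps => e e0; exists (e / (`|b| + 1)); first by rewrite divr_gt0// ltr_wpDl.
move=> s; rewrite ltr_pdivlMr ?ltr_wpDl// => sb.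
rewrite [X in `|X|](_ : _ = (s * b) * s); last by ring.
rewrite normrM ler_wpM2r// normrM; apply: le_trans (ltW sb).
by rewrite ler_wpM2l// lerDl.
Qed.

(** Subtracting the quadratic model along the segment leaves [F], whose derivative is at most 0 by
    the Lipschitz bound and Cauchy-Schwarz. The mean value theorem then gives [F 1 <= F 0] without
    integrating the gradient. *)
Lemma descent_lemma (L : R) (x v : 'cV[R]_n) :
  (forall a b, U a -> U b -> nrm (gh a - gh b) <= L * nrm (a - b)) ->
  (forall t : R, 0 <= t <= 1 -> U (x + t *: v)) ->
  h (x + v) <= h x + dotp (gh x) v + L / 2 * nrm v ^+ 2.
Proof.
move=> lip seg.
pose q (t : R) := t * dotp (gh x) v + t ^+ 2 * (L / 2 * nrm v ^+ 2).
pose F (t : R) := h (x + t *: v) - q t.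
pose dF (t : R) := dotp (gh (x + t *: v)) v - (dotp (gh x) v + 2 * t * (L / 2 * nrm v ^+ 2)).
have FdF (t : R) : 0 <= t <= 1 -> is_derive t 1 F (dF t).
  move=> t01; apply: is_deriveB; last exact: is_derive_quadratic.
  by apply: is_derive_along_line; exact: seg.
have [t||t t01] := @MVT _ F dF 0 1 ltr01.
- by rewrite in_itv/= => /andP[t0 t1]; apply: FdF; rewrite !ltW.
- by apply: derivable_within_continuous => s; rewrite in_itv/= => /FdF[].
move: t01; rewrite in_itv/= => /andP[t0 t1].
rewrite /F /dF /q !scale0r !scale1r !addr0 subr0 mulr1.
have x0 : U x by rewrite -[x]addr0 -(scale0r v); apply: seg; rewrite lexx ler01.
have := lip _ _ (seg t (introT andP (conj (ltW t0) (ltW t1)))) x0.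
rewrite [x + _ - x]addrAC subrr add0r nrmZ gtr0_norm// => lipt.
have := dotp_le_nrm (gh (x + t *: v) - gh x) v; rewrite !dotpE.
have := ler_wpM2r (nrm_ge0 v) lipt; rewrite expr2; nra.
Qed.

End Smoothness.

(** * The Fenchel conjugate and its proximal map *)

Section Conjugate.
Context {R : realType} {s : nat}.
Local Set Implicit Arguments.
Local Unset Strict Implicit.
Variable g : 'cV[R]_s -> \bar R.
Hypothesis gproper : proper_fun g.

Lemma edom_fin w : edom g w -> g w = (fine (g w))%:E.
Proof. by move=> gw; rewrite fineK// fin_numE gproper.1 lt_eqF. Qed.

(** Points outside [edom g] contribute [-oo] to the supremum, so a bound on the conjugate is a
    family of real affine inequalities. Closedness, convexity and Fenchel-Young all follow from this
    form. *)
Lemma fconj_leP z r :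
  (fconj g z <= r%:E)%E <-> forall w, edom g w -> dotp z w - fine (g w) <= r.
Proof.
split=> [le w gw|le].
  rewrite -lee_fin EFinB -edom_fin//; apply: le_trans le.
  by apply: ereal_sup_ubound; exists w.
apply: ge_ereal_sup => _ [w _ <-]; have [gw|gw] := pselect (edom g w).
  by rewrite (edom_fin gw) -EFinB lee_fin; exact: le.
move/negP : gw; rewrite -leNgt leye_eq => /eqP ->.
by rewrite leNye.
Qed.

Lemma fconj_gtNy z : (-oo < fconj g z)%E.
Proof.
have [w gw] := gproper.2; apply: (@lt_le_trans _ _ ((dotp z w)%:E - g w)%E).
  by rewrite (edom_fin gw) -EFinB ltNyr.
by apply: ereal_sup_ubound; exists w.
Qed.

Lemma fconj_fin_leP z r :
  (fconj g z <= r%:E)%E <-> fconj g z \is a fin_num /\ fine (fconj g z) <= r.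
Proof.
have := fconj_gtNy z; case: (fconj g z) => [a| |]//= _; rewrite ?lee_fin.
  by split=> [|[]].
by rewrite leye_eq; split=> [|[]].
Qed.

Lemma fenchel_young z w : fconj g z \is a fin_num -> edom g w ->
  dotp z w <= fine (g w) + fine (fconj g z).
Proof.
move=> gz gw; have /fconj_leP/(_ w gw) : (fconj g z <= (fine (fconj g z))%:E)%E.
  by rewrite fineK.
lra.
Qed.

Lemma closed_fconj_le r : closed [set z | (fconj g z <= r%:E)%E].
Proof.
rewrite (_ : [set _ | _] = \bigcap_(w in edom g) [set z | dotp z w <= r + fine (g w)]).
  apply: closed_bigI => w _.
  have /continuous_closedP/(_ _ (@closed_le R (r + fine (g w)))) : continuous (fun z : 'cV[R]_s => dotp z w).
    move=> z; apply: (@cvg_dotp _ _ (nbhs z) _ _ id (fun=> w) z w).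
      exact: cvg_id.
    exact: cvg_cst.
  exact.
apply/seteqP; split=> z /=.
  by move/fconj_leP => le w /le; rewrite lerBlDr.
by move=> le; apply/fconj_leP => w /le /=; rewrite lerBlDr.
Qed.

Lemma fconj_convex_on : convex_on [set z | fconj g z \is a fin_num] (fine \o fconj g).
Proof.
move=> z w t /= gz gw /andP[t0 t1]; apply/fconj_fin_leP/fconj_leP => v gv.
have := fenchel_young gz gv; have := fenchel_young gw gv.
rewrite !dotpE; nra.
Qed.

(** Equality case of Fenchel-Young: the subgradient inequality bounds the conjugate from above,
    Fenchel-Young from below. *)
Lemma fconj_subdiff x v : subdiff g x v ->
  fconj g v \is a fin_num /\ fine (fconj g v) = dotp v x - fine (g x).
Proof.
move=> [gx le].
have gdx : edom g x by rewrite /edom/= -(fineK gx) ltry.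
have /fconj_fin_leP[fin le1] : (fconj g v <= (dotp v x - fine (g x))%:E)%E.
  apply/fconj_leP => w gw; have := le w.
  rewrite -(fineK gx) (edom_fin gw) -EFinD lee_fin dotpDr dotpNr; lra.
split=> //; have := fenchel_young fin gdx; lra.
Qed.

(** [prox] is a choice with default 0, so it is a minimizer only once one is known to exist;
    [strongly_convex_argmin] supplies it. The extra square is the growth away from the minimizer. *)
Lemma prox_fconj kappa a : (exists z, fconj g z \is a fin_num) -> 0 < kappa ->
  let p := prox (fconj g) kappa a in fconj g p \is a fin_num /\
  forall z, fconj g z \is a fin_num ->
    fine (fconj g p) + (2 * kappa)^-1 * nrm (p - a) ^+ 2 + (2 * kappa)^-1 * nrm (z - p) ^+ 2
    <= fine (fconj g z) + (2 * kappa)^-1 * nrm (z - a) ^+ 2.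
Proof.
move=> [z0 gz0] k0; set c := (2 * kappa)^-1; move=> p.
have c0 : 0 < c by rewrite invr_gt0 mulr_gt0.
pose D := [set z | fconj g z \is a fin_num].
have [w0 gw0] := gproper.2.
(* A point [w0] of [edom g] gives an affine minorant of the conjugate; adding the quadratic and
   completing the square yields this lower bound. *)
have [||x Dx|p0 [Dp0 p0min]] := @strongly_convex_argmin _ _ D (fine \o fconj g) c a
  (dotp a w0 - fine (g w0) - dotp w0 w0 / (4 * c)) c0 _ fconj_convex_on.
- by exists z0.
- move=> r; rewrite (_ : [set _ | _] = [set z | (fconj g z <= r%:E)%E]).
    exact: closed_fconj_le.
  by apply/seteqP; split=> z /fconj_fin_leP.
- have := fenchel_young Dx gw0; rewrite /= nrm_sqr.
  have : 0 <= c * dotp (x - a + (2 * c)^-1 *: w0) (x - a + (2 * c)^-1 *: w0).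
    by rewrite mulr_ge0 ?dotp_ge0 ?ltW.
  rewrite !dotpE !(dotpC w0) !(dotpC a) [X in 0 <= X](_ : _ = c * dotp (x - a) (x - a)
     + dotp x w0 - dotp a w0 + dotp w0 w0 / (4 * c)); last first.
    by rewrite !dotpE !(dotpC w0) !(dotpC a); field; rewrite gt_eqF.
  rewrite !dotpE !(dotpC w0) !(dotpC a); lra.
have [gp pmin] : fconj g p \is a fin_num /\ forall z, 
     (fconj g p + (c * nrm (p - a) ^+ 2)%:E <= fconj g z + (c * nrm (z - a) ^+ 2)%:E)%E.
  apply: (@xgetPex _ 0 [set p | fconj g p \is a fin_num /\ forall z,
     (fconj g p + (c * nrm (p - a) ^+ 2)%:E <= fconj g z + (c * nrm (z - a) ^+ 2)%:E)%E]).
  exists p0; split=> // z; have := fconj_gtNy z; case E : (fconj g z) => [r| |]// _.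
    have Dz : D z by rewrite /D/= E.
    by rewrite -(fineK Dp0) -!EFinD lee_fin; have := p0min z Dz; rewrite /= E.
  by rewrite addye// leey.
split=> // z gz; apply: (strongly_convex_growth fconj_convex_on _ gp gz) => w gw.
by rewrite -lee_fin !EFinD /= !fineK; [exact: pmin|exact: gw|exact: gp].
Qed.

End Conjugate.

(* Unqualified, [convex_set] is the one of MathComp-Analysis, which shadows that of Defs. *)
Lemma convex_set_combination {R : realType} {n} (S : set 'cV[R]_n) :
  convex_set S -> Defs.convex_set S.
Proof.
move=> cS x y t Sx Sy /andP[t0 t1].
by have := cS x y (Itv01 t0 t1); rewrite !inE; apply.
Qed.

(** Projection is the case [phi = 0], [c = 1] of strongly convex minimization; the second square is
    again the growth term. *)
Lemma ProjP {R : realType} {n} (S : set 'cV[R]_n) (a : 'cV[R]_n) :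
  S !=set0 -> convex_set S -> closed S ->
  S (Proj S a) /\ forall x, S x ->
    nrm (Proj S a - a) ^+ 2 + nrm (x - Proj S a) ^+ 2 <= nrm (x - a) ^+ 2.
Proof.
move=> S0 Sconv Sclo.
have cvx : convex_on S (fun=> 0 : R).
  move=> x y t Sx Sy /andP[t0 t1]; split; last by rewrite !mulr0 addr0.
  have t01 : 0 <= t <= 1 by rewrite !ltW.
  exact: (convex_set_combination S Sconv x y t Sx Sy t01).
have [|x Sx|p [Sp pmin]] := strongly_convex_argmin (a := a) (lb := 0) (@ltr01 R) S0 cvx.
- move=> r /=.
    have [r0|r0] := leP 0 r.
    rewrite [X in closed X](_ : _ = S)//.
    by apply/seteqP; split=> [x []|].
  rewrite [X in closed X](_ : _ = set0); first exact: closed0.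
  by apply/seteqP; split=> [x [_] |]//; rewrite leNgt r0.
- by rewrite add0r mul1r sqr_ge0.
have [SP Pmin] : S (Proj S a) /\ forall y, S y -> nrm (Proj S a - a) <= nrm (y - a).
  apply: (@xgetPex _ 0 [set p | S p /\ forall y, S y -> nrm (p - a) <= nrm (y - a)]).
  exists p; split=> // y /pmin; rewrite !add0r !mul1r.
  by rewrite ler_pXn2r ?nnegrE ?nrm_ge0.
split=> // x Sx.
have := @strongly_convex_growth _ _ S (fun=> 0) 1 a (Proj S a) x cvx _ SP Sx.
rewrite !add0r !mul1r; apply => w Sw.
by rewrite !add0r !mul1r ler_pXn2r ?nnegrE ?nrm_ge0// Pmin.
Qed.

(** * Limits of function values, subgradients and proximal points *)

Lemma closed_sublevel_eventually_gt {R : realType} {n} (G : 'cV[R]_n -> \bar R)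
    (w : nat -> 'cV[R]_n) (a : 'cV[R]_n) (r : R) :
  lsc_fun G -> w @ \oo --> a -> (r%:E < G a)%E -> \forall i \near \oo, (r%:E < G (w i))%E.
Proof.
move=> lscG wa ra.
have : open_nbhs a (~` [set x | (G x <= r%:E)%E]).
  by split; [exact: (closed_openC (lscG r))|apply/negP; rewrite -ltNge].
move=> /open_nbhs_nbhs /wa ev.
by apply: (@filterS _ \oo _ _ _ _ ev) => i /negP; rewrite -ltNge.
Qed.

Section ConvexLimits.
Context {R : realType}.

(** Lower semicontinuity bounds the values from below; the bound [b] from above comes from an
    optimality or subgradient inequality. *)
Lemma lsc_cvg {n} (G : 'cV[R]_n -> \bar R) (w : nat -> 'cV[R]_n) (a : 'cV[R]_n)
    (b : nat -> R) :
  lsc_fun G -> w @ \oo --> a -> G a \is a fin_num ->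
  (\forall i \near \oo, G (w i) \is a fin_num /\ fine (G (w i)) <= b i) ->
  b @ \oo --> fine (G a) -> fine (G (w i)) @[i --> \oo] --> fine (G a).
Proof.
move=> lscG wa Ga le_b ba; apply/cvgrPdist_le => e e0.
have gt_near : \forall i \near \oo, ((fine (G a) - e)%:E < G (w i))%E.
  apply: (closed_sublevel_eventually_gt G w a) => //.
  by rewrite -[ltRHS]fineK// lte_fin; lra.
have b_near : \forall i \near \oo, b i <= fine (G a) + e by apply: (cvgr_le _ ba); lra.
near=> i.
have [Gw Gb] : G (w i) \is a fin_num /\ fine (G (w i)) <= b i by near: i.
have be : b i <= fine (G a) + e by near: i.
have : ((fine (G a) - e)%:E < G (w i))%E by near: i.
rewrite -(fineK Gw) lte_fin ler_norml => gt; apply/andP; split; lra.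
Unshelve. all: by end_near. Qed.

(** The subgradient inequality tested at [a] is the upper bound that [lsc_cvg] asks for. Once the
    values converge, the inequality at any [y] passes to the limit. *)
Lemma subdiff_cvg {n} (f : 'cV[R]_n -> \bar R) (w v : nat -> 'cV[R]_n)
    (a b : 'cV[R]_n) :
  proper_fun f -> lsc_fun f -> edom f a -> w @ \oo --> a -> v @ \oo --> b ->
  (forall i, subdiff f (w i) (v i)) ->
  subdiff f a b /\ fine (f (w i)) @[i --> \oo] --> fine (f a).
Proof.
move=> fproper flsc fa wa vb sub.
have fa_fin : f a \is a fin_num by rewrite (edom_fin fproper fa).
have lin y : dotp (v i) (y - w i) @[i --> \oo] --> dotp b (y - a).
  by apply: cvg_dotp => //; apply: cvgB => //; exact: cvg_cst.
have fw_cvg : fine (f (w i)) @[i --> \oo] --> fine (f a).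
  apply: (lsc_cvg _ _ _ (fun i => fine (f a) - dotp (v i) (a - w i)) flsc wa fa_fin).
    apply: nearW => i; have [fwi le] := sub i; split=> //; move: (le a).
    by rewrite -(fineK fwi) -[in X in (_ <= X)%E](fineK fa_fin) -EFinD lee_fin /=; lra.
  rewrite [X in _ --> X](_ : _ = fine (f a) - dotp b (a - a)); last first.
    by rewrite subrr -(scale0r (0 : 'cV[R]_n)) dotpZr mul0r subr0.
  by apply: cvgB; [exact: cvg_cst|exact: lin].
split=> //; split=> // y.
have [fy|/negP] := pselect (edom f y); last first.
  by rewrite -leNgt leye_eq => /eqP ->; rewrite leey.
rewrite -(fineK fa_fin) (edom_fin fproper fy) -EFinD lee_fin.
have cvg_minorant : fine (f (w i)) + dotp (v i) (y - w i) @[i --> \oo]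
    --> fine (f a) + dotp b (y - a) by apply: cvgD => //; exact: lin.
apply: (cvgr_to_le cvg_minorant).
apply: nearW => i; have [fwi /(_ y)] := sub i.
by rewrite -[in X in (X <= _)%E](fineK fwi) (edom_fin fproper fy) -EFinD lee_fin.
Qed.

(** Expanding the square drops a constant and leaves a linear term in [b]. With [b = A *m x] the
    proximal objective is the negative of the [z]-part of [Psi]. *)
Lemma prox_fconj_linear {s} (g : 'cV[R]_s -> \bar R) (gamma : R) (b : 'cV[R]_s) :
  proper_fun g -> (exists z, fconj g z \is a fin_num) -> 0 < gamma ->
  let p := prox (fconj g) gamma^-1 (gamma^-1 *: b) in fconj g p \is a fin_num /\
  forall w, fconj g w \is a fin_num ->
    fine (fconj g p) - dotp p b + gamma / 2 * nrm p ^+ 2 + gamma / 2 * nrm (w - p) ^+ 2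
    <= fine (fconj g w) - dotp w b + gamma / 2 * nrm w ^+ 2.
Proof.
move=> gproper dom gamma0; have gammaV : 0 < gamma^-1 by rewrite invr_gt0.
have [gp pmin] := prox_fconj gproper (gamma^-1 *: b) dom gammaV.
move=> p; split=> // w /pmin; rewrite -/p invfM invrK.
have quad y : 2^-1 * gamma * nrm (y - gamma^-1 *: b) ^+ 2
  = gamma / 2 * nrm y ^+ 2 - dotp y b + dotp b b / (2 * gamma).
  by rewrite !nrm_sqr !dotpE (dotpC b); field; rewrite gt_eqF.
rewrite !quad (mulrC 2^-1); lra.
Qed.

Lemma fconj_lsc {s} (g : 'cV[R]_s -> \bar R) : proper_fun g -> lsc_fun (fconj g).
Proof. by move=> gproper r; exact: closed_fconj_le. Qed.

(** Optimality tested against [w] bounds the conjugate at [z i] by [B w i]. Any [w] in the domain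
    shows that [zb] is in the domain; then [w = zb] gives a bound that tends to the value at
    [zb]. *)
Lemma prox_fconj_cvg {s} (g : 'cV[R]_s -> \bar R) (gamma : R) (b z : nat -> 'cV[R]_s)
    (bb zb : 'cV[R]_s) :
  proper_fun g -> (exists z, fconj g z \is a fin_num) -> 0 < gamma ->
  b @ \oo --> bb -> z @ \oo --> zb ->
  (\forall i \near \oo, z i = prox (fconj g) gamma^-1 (gamma^-1 *: b i)) ->
  fconj g zb \is a fin_num /\ fine (fconj g (z i)) @[i --> \oo] --> fine (fconj g zb).
Proof.
move=> gproper dom gamma0 bbb zzb zE.
pose B w i := fine (fconj g w) - dotp w (b i) + gamma / 2 * nrm w ^+ 2
  + (dotp (z i) (b i) - gamma / 2 * nrm (z i) ^+ 2).
have B_cvg w : B w @ \oo --> fine (fconj g w) - dotp w bb + gamma / 2 * nrm w ^+ 2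
    + (dotp zb bb - gamma / 2 * nrm zb ^+ 2).
  apply: cvgD; [apply: cvgD; [apply: cvgB|]|apply: cvgB]; try exact: cvg_cst.
  - by apply: cvg_dotp => //; exact: cvg_cst.
  - exact: cvg_dotp.
  - by apply: cvgMr; rewrite !expr2; apply: cvgM; exact: cvg_nrm.
have le_B w : fconj g w \is a fin_num ->
    \forall i \near \oo, fconj g (z i) \is a fin_num /\ fine (fconj g (z i)) <= B w i.
  move=> gw; apply: filterS zE => i zi; rewrite /B zi.
  have [gp pmin] := prox_fconj_linear g gamma (b i) gproper dom gamma0.
  split=> //; move: (pmin w gw).
  have : 0 <= gamma / 2 * nrm (w - prox (fconj g) gamma^-1 (gamma^-1 *: b i)) ^+ 2.
    by rewrite mulr_ge0 ?sqr_ge0// divr_ge0// ltW.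
  lra.
have zb_fin : fconj g zb \is a fin_num.
  have [w gw] := dom.
  pose r := fine (fconj g w) - dotp w bb + gamma / 2 * nrm w ^+ 2
    + (dotp zb bb - gamma / 2 * nrm zb ^+ 2) + 1.
  suff /(fconj_fin_leP gproper)[] : (fconj g zb <= r%:E)%E by [].
  have := closed_cvg _ (fconj_lsc g gproper r) _ _ zzb; apply.
  have Br : \forall i \near \oo, B w i <= r by apply: (cvgr_le _ (B_cvg w)); rewrite /r; lra.
  near=> i; apply/(fconj_fin_leP gproper).
  have [gz leB] : fconj g (z i) \is a fin_num /\ fine (fconj g (z i)) <= B w i.
    by near: i; exact: le_B.
  by split=> //; apply: le_trans leB _; near: i.
split=> //.
apply: (lsc_cvg _ _ _ (B zb) (fconj_lsc g gproper) zzb zb_fin (le_B _ zb_fin)).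
rewrite [X in _ --> X](_ : _ = fine (fconj g zb) - dotp zb bb + gamma / 2 * nrm zb ^+ 2
    + (dotp zb bb - gamma / 2 * nrm zb ^+ 2)); last by ring.
exact: B_cvg.
Unshelve. all: by end_near. Qed.

End ConvexLimits.

(** * One step of the algorithm *)

Section OneStep.
Context {R : realType} {n s p : nat}.
Local Set Implicit Arguments.
Local Unset Strict Implicit.
Variables (S : set 'cV[R]_n) (A : 'M[R]_(s, n)) (K : 'M[R]_(p, n)).
Variables (g : 'cV[R]_s -> \bar R) (h : 'cV[R]_n -> R) (gh : 'cV[R]_n -> 'cV[R]_n).
Variable f : 'cV[R]_p -> \bar R.

Definition potential (delta gamma : R) (x : 'cV[R]_n) (z : 'cV[R]_s) (u : 'cV[R]_n) : R :=
  dotp z (A *m x) - fine (fconj g z) + h x + delta / 2 * nrm (x - u) ^+ 2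
  - gamma / 2 * nrm z ^+ 2.

Lemma PsiE delta gamma x z u : S x -> fconj g z \is a fin_num ->
  Psi A g h S x z u delta gamma = (potential delta gamma x z u)%:E.
Proof.
by move=> Sx gz; rewrite /Psi /Defs.indic asboolT// -[in LHS](fineK gz) adde0.
Qed.

Hypotheses (S0 : S !=set0) (Sconv : convex_set S) (Sclo : closed S).

(** Completing the square absorbs the linear term [w] into the projected point, so [ProjP] becomes a
    three-point inequality. *)
Lemma Proj_gradient_step delta (x u w : 'cV[R]_n) : 0 < delta -> S x ->
  let x' := Proj S (u - delta^-1 *: w) in
  S x' /\ delta / 2 * nrm (x' - u) ^+ 2 + dotp w x' + delta / 2 * nrm (x - x') ^+ 2
    <= delta / 2 * nrm (x - u) ^+ 2 + dotp w x.
Proof.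
move=> delta0 Sx x'; have [Sx' xmin] := ProjP S (u - delta^-1 *: w) S0 Sconv Sclo.
split=> //; move: (xmin x Sx); rewrite -/x'.
have quad y : delta / 2 * nrm (y - (u - delta^-1 *: w)) ^+ 2
    = delta / 2 * nrm (y - u) ^+ 2 + dotp w y - dotp w u + dotp w w / (2 * delta).
  by rewrite !nrm_sqr !dotpE !(dotpC w) (dotpC u y); field; rewrite gt_eqF.
have delta2 : 0 <= delta / 2 by rewrite divr_ge0// ltW.
by move=> /(ler_wpM2l delta2); rewrite mulrDr !quad; lra.
Qed.

Variables (U : set 'cV[R]_n) (L nu beta gamma : R).
Hypotheses (SU : S `<=` U) (hgrad : has_gradient_on h gh U).
Hypothesis lip : forall a b, U a -> U b -> nrm (gh a - gh b) <= L * nrm (a - b).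
Hypotheses (L0 : 0 <= L) (nu0 : 0 < nu) (gamma0 : 0 < gamma) (beta02 : 0 < beta < 2).

Let delta := 2 * nu + L + 2 * opnorm A ^+ 2 / gamma.

Lemma delta_gt0 : 0 < delta.
Proof.
have : 0 <= 2 * opnorm A ^+ 2 / gamma 
  by apply: divr_ge0; [rewrite mulr_ge0// sqr_ge0|exact: ltW].
rewrite /delta; move: (_ / gamma) => X X0; move: nu0 L0 => ? ?; lra.
Qed.

(** [U] may fail to be convex, but the segment from [x] to [x'] stays in [S], hence in [U]. *)
Lemma descent_on_convex (x x' : 'cV[R]_n) : S x -> S x' ->
  h x' <= h x + dotp (gh x) (x' - x) + L / 2 * nrm (x - x') ^+ 2.
Proof.
move=> Sx Sx'; rewrite -(opprB x' x) nrmN -[X in h X <= _](subrKC x x').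
apply: (descent_lemma hgrad lip) => t t01; apply: SU.
have -> : x + t *: (x' - x) = t *: x' + (1 - t) *: x.
  by rewrite scalerBr scalerBl scale1r addrCA addrA.
exact: (convex_set_combination S Sconv).
Qed.

(* The AM-GM step absorbs the dual increment: the [2 |A|^2 / gamma] part of [delta] pays for it. *)
Lemma potential_decrease (x u : 'cV[R]_n) (y : 'cV[R]_p) (z z' : 'cV[R]_s) (theta : R) :
  let x' := Proj S (u - delta^-1 *: (gh x + A^T *m z - theta *: (K^T *m y))) in
  let u' := (1 - beta) *: u + beta *: x' in
  S x -> proper_fun f -> subdiff f (K *m x) y ->
  fconj g z \is a fin_num -> fconj g z' \is a fin_num ->
  fine (fconj g z) - dotp z (A *m x) + gamma / 2 * nrm z ^+ 2 + gamma / 2 * nrm (z' - z) ^+ 2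
    <= fine (fconj g z') - dotp z' (A *m x) + gamma / 2 * nrm z' ^+ 2 ->
  potential delta gamma x z u = theta * fine (f (K *m x)) ->
  potential delta gamma x' z' u' <=
    theta * (dotp (K *m x') y - fine (fconj f y))
    - nu * nrm (x - x') ^+ 2 - delta * (2 - beta) / (2 * beta) * nrm (u - u') ^+ 2
    - gamma / 4 * nrm (z - z') ^+ 2.
Proof.
move=> x' u' Sx fproper suby gz gz' zopt pot.
have [Sx' xstep] := Proj_gradient_step u (gh x + A^T *m z - theta *: (K^T *m y)) delta_gt0 Sx.
rewrite -/x' in Sx' xstep.
have [_ fy] := fconj_subdiff fproper suby.
have hstep := descent_on_convex Sx Sx'.
(* Here [x' - u'] is [1 - beta] times [x' - u], and [(1 - beta)^2 = 1 - beta (2 - beta)]; the loss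
   is rewritten through [u - u'], which is [beta] times [u - x']. *)
have ustep : delta / 2 * nrm (x' - u') ^+ 2 =
    delta / 2 * nrm (x' - u) ^+ 2 - delta * (2 - beta) / (2 * beta) * nrm (u - u') ^+ 2.
  have [b0 _] := andP beta02.
  have -> : x' - u' = (1 - beta) *: (x' - u).
    by apply/colP => i; rewrite !mxE; ring.
  have -> : u - u' = - (beta *: (x' - u)).
    by apply/colP => i; rewrite !mxE; ring.
  by rewrite nrmN !nrm_sqr !dotpE; field; rewrite gt_eqF.
have amgm : dotp (z' - z) (A *m (x' - x)) <=
    gamma / 4 * nrm (z - z') ^+ 2 + opnorm A ^+ 2 / gamma * nrm (x - x') ^+ 2.
  rewrite -(opprB z' z) -(opprB x' x) !nrmN; apply: (le_trans (dotp_le_nrm _ _)).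
  have := ler_wpM2l (nrm_ge0 (z' - z)) (nrm_mulmx A (x' - x)).
  move=> /le_trans; apply; move: (nrm (z' - z)) (nrm (x' - x)) (opnorm A) => a b c.
  rewrite -subr_ge0.
  rewrite [X in 0 <= X](_ : _ = gamma^-1 * (gamma / 2 * a - c * b) ^+ 2); last first.
    by field; rewrite gt_eqF.
  by rewrite mulr_ge0 ?sqr_ge0// invr_ge0 ltW.
rewrite /potential ustep fy.
(* Half of [delta] is [nu + L / 2 + aL]: the last two parts cancel the errors of [hstep] and [amgm],
   leaving [nu]. The dual gain [gamma / 2] minus the [gamma / 4] spent in [amgm] leaves [gamma / 4].
   By [fy], the linearization turns [theta * fine (f (K *m x))] into the leading term. *)
move: pot xstep hstep zopt amgm; rewrite /potential -(opprB z' z) nrmN.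
rewrite !mulmxBr !dotpE !dotp_trmx !(dotpC z) !(dotpC z') !(dotpC _ y) /delta.
set aL := opnorm A ^+ 2 / gamma; rewrite -!(mulrA 2 (opnorm A ^+ 2)) -/aL.
move: (nrm (x - u) ^+ 2) (nrm (x' - u) ^+ 2) (nrm (x - x') ^+ 2) (nrm (u - u') ^+ 2)
  (nrm (z' - z) ^+ 2) (nrm z ^+ 2) (nrm z' ^+ 2) => a1 a2 a3 a4 a5 a6 a7.
lra.
Qed.

End OneStep.

(** The interlacing makes [G] nonincreasing from [N] on and bounded below by 0, and squeezes [th]
    between the shift of [G] and [G]. *)
Lemma interlaced_cvg {R : realType} (G th : nat -> R) N :
  (forall k, (N <= k)%N -> 0 <= th k /\ G k.+1 <= th k /\ th k <= G k) ->
  exists l : R, G @ \oo --> l /\ th @ \oo --> l.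
Proof.
move=> H.
have Gdec : nonincreasing_seq (fun k => G (k + N)%N).
  by apply/nonincreasing_seqP => k; have [_ [? ?]] := H (k + N)%N (leq_addl _ _); lra.
have /cvg_ex[l Gl] : cvgn (fun k => G (k + N)%N).
  apply: nonincreasing_is_cvgn => //; exists 0 => _ [k _ <-].
  by have [? [_ ?]] := H (k + N)%N (leq_addl _ _); lra.
have {}Gl : G @ \oo --> l by move: Gl; rewrite cvg_shiftn.
 exists l; split=> //.
apply: (@squeeze_cvgr _ _ _ _ (fun k => G k.+1) G) => //.
  by exists N => // k /= Nk; have [_ [-> ->]] := H k Nk.
by rewrite cvg_shiftS.
Qed.

(** * Assembly of the three claims *)

Theorem theorem5p4 (R : realType) (n s p : nat)
  (S : set 'cV[R]_n) (A : 'M[R]_(s, n)) (K : 'M[R]_(p, n))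
  (g : 'cV[R]_s -> \bar R) (h : 'cV[R]_n -> R) (gh : 'cV[R]_n -> 'cV[R]_n)
  (Lh : R) (f : 'cV[R]_p -> \bar R) (ell : R)
  (* standing assumptions *)
  (hS0 : S !=set0) (hSconv : convex_set S) (hScomp : compact S)
  (hg : proper_fun g /\ convex_fun g /\ lsc_fun g)
  (hLh : 0 <= Lh)
  (hh : exists U : set 'cV[R]_n, open U /\ S `<=` U /\ has_gradient_on h gh U /\
          forall x x', U x -> U x' -> nrm (gh x - gh x') <= Lh * nrm (x - x'))
  (hf : proper_fun f /\ convex_fun f /\ lsc_fun f)
  (hfK : forall x, S x -> interior (edom f) (K *m x))
  (hfpos : forall x, S x -> (0 < f (K *m x))%E)
  (hSg : exists2 x, S x & edom g (A *m x))
  (hinf : (0 < ereal_inf [set (g (A *m x) + (h x)%:E)%E | x in S])%E)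
  (hdomsub : forall x, S x -> subdiff g (A *m x) !=set0)
  (hell : 0 < ell)
  (hdist : forall x, S x -> dist0 (subdiff g (A *m x)) <= ell)
  (* algorithm parameters *)
  (beta nu q delta0 theta0 eps : R)
  (hbeta : 0 < beta < 2) (hnu : 0 < nu) (hq : 0 < q < 1)
  (hdelta0 : 0 < delta0) (htheta0 : 0 < theta0) (heps : 0 < eps)
  (* iterates *)
  (x u : nat -> 'cV[R]_n) (y : nat -> 'cV[R]_p) (z : nat -> 'cV[R]_s)
  (theta gam del : nat -> R) (j : nat -> nat)
  (hgam0 : gam 0%N = 1) (hdel0 : del 0%N = delta0) (htheta0' : theta 0%N = theta0)
  (hy : forall k, subdiff f (K *m x k) (y k.+1))
  (hx : forall k, x k.+1 = Proj S (u k + (theta k / del k) *: (K^T *m y k.+1)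
                                  - (del k)^-1 *: gh (x k) - (del k)^-1 *: (A^T *m z k)))
  (hu : forall k, u k.+1 = (1 - beta) *: u k + beta *: x k.+1)
  (hj : forall k,
      0 < cand_ratio A K g h f S q (gam k) (del k) (x k.+1) (u k.+1) (j k) /\
      forall i, (i < j k)%N ->
        ~ (0 < cand_ratio A K g h f S q (gam k) (del k) (x k.+1) (u k.+1) i))
  (htheta : forall k,
      theta k.+1 = cand_ratio A K g h f S q (gam k) (del k) (x k.+1) (u k.+1) (j k))
  (hz : forall k, z k.+1 = cand_z A g q (gam k) (x k.+1) (j k))
  (hgam : forall k, gam k.+1 =
      (if Num.min (eps / (gam k * q ^+ j k)) (Num.sqrt (2 * eps / (gam k * q ^+ j k)))
          < nrm (z k.+1)
       then gam k * q ^+ j k * q else gam k * q ^+ j k))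
  (hdel : forall k, del k.+1 = 2 * nu + Lh + 2 * opnorm A ^+ 2 / gam k.+1)
  (* hypotheses of the theorem *)
  (gb : R) (hgb : 0 < gb) (K0 : nat)
  (hK0 : forall k, (K0 <= k)%N ->
      gam k = gb /\ del k = 2 * nu + Lh + 2 * opnorm A ^+ 2 / gb /\
      nrm (z k.+1) <= Num.min (eps / gb) (Num.sqrt (2 * eps / gb)))
  (m M : R) (hm : 0 < m) (hmM : m <= M)
  (hfbd : forall k, (1 <= k)%N -> (m%:E < f (K *m x k))%E /\ (f (K *m x k) <= M%:E)%E)
  (K1 : nat) (hK1 : (K0.+1 <= K1)%N)
  (hK1bd : forall k, (K1 <= k)%N ->
      (m%:E <= (dotp (K *m x k) (y k))%:E - fconj f (y k))%E /\
      ((dotp (K *m x k) (y k))%:E - fconj f (y k) <= f (K *m x k))%E /\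
      (f (K *m x k) <= M%:E)%E) :
  let delb := 2 * nu + Lh + 2 * opnorm A ^+ 2 / gb in
  let Gamma := Gam A K g h f S delb gb in
  (* (i) sufficient decrease *)
  (exists2 c : R, 0 < c & forall k, (K1 <= k)%N ->
     (Gamma (x k.+1) (y k.+1) (z k.+1) (u k.+1)
      <= Gamma (x k) (y k) (z k) (u k)
         - (c * nrm (x k - x k.+1) ^+ 2)%:E
         - (c * nrm (u k - u k.+1) ^+ 2)%:E
         - (c * nrm (z k - z k.+1) ^+ 2)%:E)%E) /\
  (* theta_k converges to thetabar; (ii) and (iii) *)
  (exists thb : R,
     theta @ \oo --> thb /\
     (fun k => Gamma (x k) (y k) (z k) (u k)) @ \oo --> thb%:E /\
     forall xb yb zb ub, accum_pt x y z u xb yb zb ub ->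
       Gamma xb yb zb ub = thb%:E).
Proof.
move=> delb Gamma.
have [U [_ [SU [hgrad lip]]]] := hh.
have [[gproper _] [fproper [_ flsc]]] := (hg, hf).
have Sclo : closed S by apply: compact_closed => //; exact: norm_hausdorff.
have dom_conj : exists w, fconj g w \is a fin_num.
  have [x0 Sx0] := hS0; have [v /(fconj_subdiff gproper)[gv _]] := hdomsub _ Sx0.
  by exists v.
(* The starting point [x 0] may lie outside [S]; every later iterate is a projection. *)
have xS k : S (x k.+1) by rewrite hx; have [] := ProjP S (u k + (theta k / del k) *: (K^T *m y k.+1)
  - (del k)^-1 *: gh (x k) - (del k)^-1 *: (A^T *m z k)) hS0 hSconv Sclo.
have fK_fin k : f (K *m x k) \is a fin_num by have [] := hy k.
have fconj_y k : fconj f (y k.+1) \is a fin_num by have [] := fconj_subdiff fproper (hy k).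
(* Since gamma is constant from K0 on, no backtracking takes place any more. *)
have j0 k : (K0 <= k)%N -> j k = 0%N.
  move=> Kk; have [q0 q1] := andP hq.
  have [gk _] := hK0 k Kk; have [gk1 _] := hK0 k.+1 (leqW Kk).
  have pow_eq0 i : gb * q ^+ i = gb -> i = 0%N.
    move=> e; apply/eqP; rewrite -[_ == _]negbK -(exprn_ilt1 i (ltW q0) q1) -leNgt.
    by rewrite -(ler_pM2l hgb) mulr1 e.
  move: (hgam k); rewrite gk gk1; case: ifP => _ /esym; last exact: pow_eq0.
  by rewrite -mulrA -exprSr => /pow_eq0.
have zE k : (K0 <= k)%N -> z k.+1 = prox (fconj g) gb^-1 (gb^-1 *: (A *m x k.+1)).
  by move=> Kk; rewrite hz /cand_z j0// expr0 mulr1 (hK0 k Kk).1.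
have z_opt k : (K0 < k)%N -> fconj g (z k) \is a fin_num /\
    forall w, fconj g w \is a fin_num ->
    fine (fconj g (z k)) - dotp (z k) (A *m x k) + gb / 2 * nrm (z k) ^+ 2
      + gb / 2 * nrm (w - z k) ^+ 2
    <= fine (fconj g w) - dotp w (A *m x k) + gb / 2 * nrm w ^+ 2.
  by case: k => // k Kk; rewrite (zE k Kk); exact: prox_fconj_linear.
pose P k := potential A g h delb gb (x k) (z k) (u k).
pose d k := dotp (K *m x k) (y k) - fine (fconj f (y k)).
pose G k := P k / d k.
have PE k : (K0 < k)%N -> Psi A g h S (x k) (z k) (u k) delb gb = (P k)%:E.
  by move=> Kk; apply: PsiE; [case: k Kk|have [] := z_opt k Kk].
have GE k : (K0 < k)%N -> Gamma (x k) (y k) (z k) (u k) = (G k)%:E.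
  by move=> Kk; rewrite /Gamma /Gam PE// -EFinM.
have fK_gt0 k : 0 < fine (f (K *m x k.+1)) by rewrite -lte_fin fineK// hfpos.
have theta_pos k : 0 < theta k.+1 by rewrite htheta; have [] := hj k.
(* [theta k.+1] is computed with [del k] and [gam k], which are constant from [K0] on; hence the
   identity starts one index later. *)
have theta_P k : (K0 < k)%N -> P k = theta k * fine (f (K *m x k)).
  case: k => // k Kk; have [gk [dk _]] := hK0 k Kk.
  rewrite htheta /cand_ratio -hz gk dk j0// expr0 mulr1 -/delb PE//= divfK//.
  by rewrite gt_eqF.
have d_bounds k : (K1 <= k)%N -> m <= d k /\ d k <= fine (f (K *m x k)) /\ d k <= M.
  case: k => [|k] Kk; first by move: (leq_trans hK1 Kk).
  have [] := hK1bd _ Kk; rewrite -(fineK (fconj_y k)) -(fineK (fK_fin k.+1)) -EFinB !lee_fin.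
  by rewrite /d => ? [? ?]; do !split=> //; lra.
have [b0 b2] := andP hbeta.
have M0 : 0 < M by exact: lt_le_trans hm hmM.
have del_gt0 : 0 < delb by exact: (@delta_gt0 _ _ _ A Lh nu gb).
(* The smallest of the three coefficients in [potential_decrease]; the middle one is positive
   because [beta < 2]. *)
pose c0 := Num.min nu (Num.min (delb * (2 - beta) / (2 * beta)) (gb / 4)).
have c0_gt0 : 0 < c0.
  by rewrite !lt_min hnu !divr_gt0 ?mulr_gt0// subr_gt0.
pose incr k := nrm (x k - x k.+1) ^+ 2 + nrm (u k - u k.+1) ^+ 2 + nrm (z k - z k.+1) ^+ 2.
have incr_ge0 k : 0 <= incr k by rewrite !addr_ge0 ?sqr_ge0.
have decrease k : (K0 < k)%N -> P k.+1 <= theta k * d k.+1 - c0 * incr k.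
  move=> Kk; have [zk zk_opt] := z_opt k Kk; have [zk1 _] := z_opt k.+1 (ltnW Kk).
  have Sxk : S (x k) by case: k Kk {zk zk_opt zk1}.
  have [_ [dk _]] := hK0 k (ltnW Kk).
  have xk1 : x k.+1 = Proj S (u k - delb^-1 *: (gh (x k) + A^T *m z k - theta k *: (K^T *m y k.+1))).
    rewrite hx dk -/delb; congr (Proj S _); apply/colP => i; rewrite !mxE; ring.
  have := potential_decrease hS0 hSconv Sclo SU hgrad lip hLh hnu hgb hbeta Sxk fproper (hy k) zk zk1
     (zk_opt _ zk1) (theta_P k Kk).
  rewrite -/delb -xk1 -hu -/(P k.+1) -/(d k.+1) => /le_trans; apply.
  have c1 : c0 <= nu by rewrite ge_min lexx.
  have c2 : c0 <= delb * (2 - beta) / (2 * beta) by rewrite !ge_min lexx orbT.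
  have c3 : c0 <= gb / 4 by rewrite !ge_min lexx !orbT.
  have := ler_wpM2r (sqr_ge0 (nrm (x k - x k.+1))) c1.
  have := ler_wpM2r (sqr_ge0 (nrm (u k - u k.+1))) c2.
  have := ler_wpM2r (sqr_ge0 (nrm (z k - z k.+1))) c3.
  rewrite /incr; lra.
(* Dividing [decrease] by [d k.+1 <= M] costs a factor [M] in the constant. The bound
   [theta k <= G k] uses [d k <= f (K x^k)] and [theta k > 0], the latter available since [k] is at
   least 1. *)
have step k : (K1 <= k)%N -> 0 <= theta k /\ G k.+1 <= theta k - c0 / M * incr k /\ theta k <= G k.
  move=> Kk; have Kk0 := leq_trans hK1 Kk; have [dm [df dM]] := d_bounds k Kk.
  have [dm1 [_ dM1]] := d_bounds k.+1 (leqW Kk).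
  have th0 : 0 < theta k by case: k Kk Kk0 {dm df dM dm1 dM1}.
  split; first exact: ltW.
  split; last by rewrite ler_pdivlMr ?(lt_le_trans hm)// theta_P// ler_wpM2l// ltW.
  rewrite ler_pdivrMr ?(lt_le_trans hm)//; apply: le_trans (decrease k Kk0) _.
  rewrite mulrBl lerD2l lerN2 [leLHS](_ : _ = c0 * incr k * (d k.+1 / M)); last by ring.
  by rewrite ler_piMr ?mulr_ge0 ?(ltW c0_gt0)// ler_pdivrMr// mul1r.
have [thb [Gthb ththb]] : exists l : R, G @ \oo --> l /\ theta @ \oo --> l.
  apply: (interlaced_cvg _ _ K1) => k Kk; have [? [? ?]] := step k Kk; do !split=> //.
  have : 0 <= c0 / M * incr k by rewrite mulr_ge0// divr_ge0// ltW.
  lra.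
split.
  exists (c0 / M); first exact: divr_gt0.
  move=> k Kk; have Kk0 := leq_trans hK1 Kk; have [_ [dec le_G]] := step k Kk.
  rewrite (GE k Kk0) (GE k.+1 (leqW Kk0)) -!EFinB lee_fin; move: dec; rewrite /incr !mulrDr.
  move: le_G; lra.
exists thb; split=> //; split.
  apply: (@cvg_trans _ ((EFin \o G) @ \oo)).
    apply: near_eq_cvg; exists K1 => // k /= Kk; rewrite GE//; exact: leq_trans hK1 Kk.
  by apply: cvg_EFin; [exact: nearW|].
move=> xb yb zb ub [phi [phiS [xphi [yphi [zphi uphi]]]]].
have phi_ge i : (i <= phi i)%N by elim: i => // i IH; exact: leq_ltn_trans IH (phiS i).
(* Reindexing [phi] so that the predecessor iterate exists and both lie beyond K1. *)
pose r i := (phi (K1 + i).+1).-1.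
have rE i : (r i).+1 = phi (K1 + i).+1 by rewrite prednK// (leq_ltn_trans _ (phi_ge _)).
have r_ge i : (K1 + i <= r i)%N by rewrite -ltnS rE; exact: phi_ge.
have r_oo : r @ \oo --> \oo.
  move=> B [N _ NB]; exists N => // i /= Ni; apply: NB => /=.
  exact: leq_trans Ni (leq_trans (leq_addl _ _) (r_ge i)).
have r_K0 i : (K0 <= r i)%N by exact: leq_trans (ltnW hK1) (leq_trans (leq_addr _ _) (r_ge i)).
have sub T (w : nat -> T) (F : set_system T) : (w \o phi) @ \oo --> F -> w (r i).+1 @[i --> \oo] --> F.
  move=> wF; apply: cvg_trans wF => B [N _ NB]; exists N => // i /= Ni.
  by rewrite rE; apply: NB; rewrite /= (leq_trans Ni)// leqW// leq_addl.
(* By [step] the squared increments are at most [M / c0 * (theta k - G k.+1)], and both sequences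
   tend to [thb]. *)
have diff0 : nrm (x k - x k.+1) @[k --> \oo] --> 0.
  have sqr0 : nrm (x k - x k.+1) ^+ 2 @[k --> \oo] --> 0.
    apply: (@squeeze_cvgr _ _ _ _ (fun=> 0) (fun k => M / c0 * (theta k - G k.+1))).
    - exists K1 => // k /= Kk; rewrite sqr_ge0/=; have [_ [dec _]] := step k Kk.
      rewrite -(ler_pM2l (divr_gt0 c0_gt0 M0)) [leRHS](_ : _ = theta k - G k.+1); last first.
        by field; rewrite !gt_eqF.
      apply: (@le_trans _ _ (c0 / M * incr k)); last by lra.
      apply: ler_wpM2l; first by rewrite divr_ge0// ltW.
      by rewrite /incr -addrA lerDl addr_ge0 ?sqr_ge0.
    - exact: cvg_cst.
    - rewrite -(mulr0 (M / c0)) -(subrr thb); apply: cvgMr; apply: cvgB => //.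
      by rewrite cvg_shiftS.
  rewrite -sqrtr0 (_ : (fun k => _) = (fun k => Num.sqrt (nrm (x k - x k.+1) ^+ 2))).
    apply: (@continuous_cvg _ _ _ \oo _ (fun k => nrm (x k - x k.+1) ^+ 2) Num.sqrt) => //.
    exact: sqrt_continuous.
  by apply/funext => k; rewrite sqrtr_sqr ger0_norm ?nrm_ge0.
have {}xphi := sub _ _ _ xphi; have {}yphi := sub _ _ _ yphi.
have {}zphi := sub _ _ _ zphi; have {}uphi := sub _ _ _ uphi.
have xr : x (r i) @[i --> \oo] --> xb.
  have d0 : x (r i) - x (r i).+1 @[i --> \oo] --> (0 : 'cV[R]_n).
    apply/cvg_nrmP; under eq_fun do rewrite subr0.
    exact: (cvg_comp r (fun k => nrm (x k - x k.+1)) r_oo diff0).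
  rewrite -[xb]add0r (_ : (fun i => _) = (fun i => (x (r i) - x (r i).+1) + x (r i).+1)).
    exact: cvgD d0 xphi.
  by apply/funext => i; rewrite subrK.
have xbS : S xb by apply: (closed_cvg _ Sclo _ _ xphi); exact: nearW.
have [zb_fin gz_cvg] : fconj g zb \is a fin_num /\
    fine (fconj g (z (r i).+1)) @[i --> \oo] --> fine (fconj g zb).
  apply: (prox_fconj_cvg g gb (fun i => A *m x (r i).+1) _ (A *m xb) _ gproper dom_conj hgb) => //.
    exact: cvg_mulmxl.
  by apply: nearW => i; exact: zE.
(* [y k.+1] is a subgradient at [K *m x k], not at [K *m x k.+1], so the limit [xr] of the
   predecessors is what is used here. *)
have [sub_yb fK_cvg] := subdiff_cvg f (fun i => K *m x (r i)) (fun i => y (r i).+1) _ _ fproper flsc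
  (interior_subset (hfK _ xbS)) (cvg_mulmxl K _ _ xr) yphi (fun i => hy (r i)).
have [yb_fin yb_val] := fconj_subdiff fproper sub_yb.
pose Pb := potential A g h delb gb xb zb ub.
pose db := dotp (K *m xb) yb - fine (fconj f yb).
have P_cvg : P (r i).+1 @[i --> \oo] --> Pb.
  apply: cvgB; [apply: cvgD; [apply: cvgD; [apply: cvgB|]|]|].
  - by apply: cvg_dotp => //; exact: cvg_mulmxl.
  - exact: gz_cvg.
  - by apply: (cvg_of_gradient hgrad); first exact: SU.
  - by apply: cvgMr; rewrite !expr2; apply: cvgM; apply: cvg_nrm; exact: cvgB.
  - by apply: cvgMr; rewrite !expr2; apply: cvgM; exact: cvg_nrm.
(* The conjugate values at [y] converge because the equality case of Fenchel-Young writes them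
   through [f] at the predecessors, whose limit is [fK_cvg]. *)
have d_cvg : d (r i).+1 @[i --> \oo] --> db.
  apply: cvgB; first by apply: cvg_dotp => //; exact: cvg_mulmxl.
  rewrite yb_val (_ : (fun i => _) =
      (fun i => dotp (y (r i).+1) (K *m x (r i)) - fine (f (K *m x (r i))))).
    by apply: cvgB => //; apply: cvg_dotp => //; exact: cvg_mulmxl.
  by apply/funext => i; have [_ ->] := fconj_subdiff fproper (hy (r i)).
(* The bound [m <= d k] survives in the limit, so the quotient [G] converges. *)
have db_gt0 : 0 < db.
  apply: lt_le_trans hm (cvgr_to_ge d_cvg _); apply: nearW => i.
  by have [] := d_bounds (r i).+1 (leqW (leq_trans (leq_addr _ _) (r_ge i))).
have G_cvg : G (r i).+1 @[i --> \oo] --> Pb / db.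
  by apply: cvgM => //; apply: cvgV => //; rewrite gt_eqF.
have G_thb : G (r i).+1 @[i --> \oo] --> thb.
  by apply: (cvg_comp r (fun k => G k.+1) r_oo); rewrite cvg_shiftS.
rewrite /Gamma /Gam PsiE// -EFinM -/Pb -/db; congr (_%:E).
by rewrite -(cvg_lim (@norm_hausdorff _ R) G_cvg) (cvg_lim (@norm_hausdorff _ R) G_thb).
Qed.
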